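(* Let $G$ be a connected unweighted graph of order $n\ge 2$. Then $$\chi(G)\ \ge\ \frac{1}{K(G)-n+2}.$$
   Context: Graphs are finite, simple, connected and undirected; unweighted means all edge weights are $1$. $\chi(G)$ is the chromatic number. $A$ is the adjacency matrix, $D$ the diagonal degree matrix, and the normalized adjacency matrix $M_G=D^{-1/2}AD^{-1/2}$ has eigenvalues $1=\lambda_1>\lambda_2\ge\cdots\ge\lambda_n\ge-1$. Kemeny's constant is $K(G)=\sum_i\pi_i m_{ji}-1$ for the random walk with transition matrix $D^{-1}A$, where $\pi$ is the stationary distribution and $m_{ji}$ the mean first passage time from $j$ to $i$ (with $m_{jj}$ the mean first return time); this does not depend on $j$, and it is known that $K(G)=\sum_{j=2}^{n}\frac{1}{1-\lambda_j}$. *)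

(* Defs.v *)
From HB Require Import structures.
From mathcomp Require Import all_boot all_order all_algebra.
From mathcomp Require Import all_classical all_reals all_analysis.

Set Implicit Arguments.
Unset Strict Implicit.
Unset Printing Implicit Defensive.

Import Order.TTheory GRing.Theory Num.Theory.

Local Open Scope ring_scope.

Record sgraph := SGraph {
  vertex :> finType;
  adj : rel vertex;
  adj_sym : symmetric adj;
  adj_irr : irreflexive adj }.

Definition connected_graph (G : sgraph) : Prop :=
  forall x y : G, connect (@adj G) x y.

Definition colorable (G : sgraph) (k : nat) : bool :=
  [exists c : {ffun G -> 'I_k}, [forall x, forall y, adj x y ==> (c x != c y)]].

Lemma ex_colorable (G : sgraph) : exists k, colorable G k.
Proof.
exists #|G|; apply/existsP; exists [ffun x => enum_rank x].
apply/forallP => x; apply/forallP => y; apply/implyP => xy.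
by rewrite !ffunE (inj_eq enum_rank_inj); apply: contraTneq xy => ->; rewrite adj_irr.
Qed.

Definition chromatic_number (G : sgraph) : nat := ex_minn (ex_colorable G).

Definition degree (G : sgraph) (x : G) : nat := #|[set y | adj x y]|.

(* The entries of D^-1 A. *)
Definition transition (R : realType) (G : sgraph) (x y : G) : R :=
  (adj x y)%:R / (degree x)%:R.

Definition stationary (R : realType) (G : sgraph) (p : G -> R) : Prop :=
  [/\ forall x, 0 <= p x, \sum_x p x = 1 &
      forall y, \sum_x p x * transition R x y = p y].

(* Probability that the walk started at x has (X_1, ..., X_t) = w. *)
Fixpoint walk_prob (R : realType) (G : sgraph) (x : G) (w : seq G) : R :=
  if w is y :: w' then transition R x y * walk_prob R y w' else 1.

(* Probability, starting at j, that the least t' >= 1 with X_t' = i is t.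
   The k-th item of w is X_(k+1), so the condition says that w meets i at its
   last item and not before; it excludes t = 0, and for j = i it gives the
   first return. *)
Definition first_passage_prob (R : realType) (G : sgraph) (j i : G) (t : nat)
    : R :=
  \sum_(w : t.-tuple G | (index i w).+1 == t) walk_prob R j w.

(* On a connected graph with at least two vertices the passage time is almost
   surely finite, so this series is its full expectation. *)
Definition mean_first_passage (R : realType) (G : sgraph) (j i : G) : \bar R :=
  (\sum_(0 <= t <oo) (t%:R * first_passage_prob R j i t)%:E)%E.

(* Kemeny's constant, computed from the starting vertex j. *)
Definition kemeny (R : realType) (G : sgraph) (p : G -> R) (j : G) : \bar R :=
  ((\sum_(i : G) (p i)%:E * mean_first_passage R j i) - 1)%E.

(* Main.v *)
Require Import Defs.
From mathcomp Require Import all_boot all_order all_algebra.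
From mathcomp Require Import all_classical all_reals all_analysis.
From mathcomp Require Import ring lra.

Set Implicit Arguments.
Unset Strict Implicit.
Unset Printing Implicit Defensive.

Import Order.TTheory GRing.Theory Num.Theory.

Local Open Scope ring_scope.

(** Let [P] be the transition matrix, [k x y = p x * P x y] the edge flow
    (symmetric, by reversibility), and
    [E(f, g) = sum p f g - sum k f g + (sum p f) (sum p g)], the form of
    [I - P + 1 p^T] in the [p]-inner product. It is positive definite; let [W]
    be its inverse, so that [E(f, W(., y)) = f y].

    The function [H_i(j) = W i i - W j i + [j = i] / p i] solves the first-step
    equations for the mean passage time to [i], and [sum_i p i * H_i(j)] is the
    trace [sum_y p y * W y y]. Hence Kemeny's constant is this trace minus 1
    (only the lower bound is needed).

    No spectral theory is needed to bound the trace from a proper colouring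
    with [n] colours: expanding [0 <= E(w - v, w - v)] for [w = W(., y)] gives
    [W y y >= 2 v y - E(v, v)] for every [v]. The choice
    [v = 1_y / p y - (1_C / p(C) - 1) / n], with [C] the colour class of [y],
    is the exact value of [w] for a balanced complete multipartite graph, and
    summing over [y] gives [#|G| - 1 + 1 / n]. *)

(** * Linear algebra on functions over a finite type *)

Lemma kernel_right_inverse (F : fieldType) (T : finType) (S : T -> T -> F) :
  (forall h : T -> F, (forall x, \sum_y S x y * h y = 0) -> forall x, h x = 0) ->
  exists W : T -> T -> F, forall x y, \sum_z S x z * W z y = (x == y)%:R.
Proof.
move=> S_inj.
pose A := \matrix_(i, j) S (enum_val i) (enum_val j) : 'M[F]_#|T|.
have sumT (f : T -> F) : \sum_x f x = \sum_(i < #|T|) f (enum_val i).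
  exact: (reindex _ (onW_bij _ (@enum_val_bij T))).
have A_unit : A \in unitmx.
  (* Injectivity of [S] on functions says that the left kernel of the transpose of [A] is
     trivial. *)
  rewrite -unitmx_tr -row_free_unit -kermx_eq0; apply/eqP/row_matrixP => i.
  set u := row i _; rewrite row0.
  have uA : u *m A^T = 0 by apply/sub_kermxP; exact: row_sub.
  have u0 : forall x, u 0 (enum_rank x) = 0.
    apply: S_inj => x; rewrite sumT.
    have /matrixP/(_ 0 (enum_rank x)) := uA; rewrite !mxE => uA0.
    rewrite -[RHS]uA0; apply: eq_bigr => k _.
    by rewrite !mxE enum_rankK enum_valK mulrC.
  apply/matrixP => a k.
  by rewrite (ord1 a) -[k]enum_valK u0 mxE.
exists (fun x y => invmx A (enum_rank x) (enum_rank y)) => x y.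
have /matrixP/(_ (enum_rank x) (enum_rank y)) := mulmxV A_unit.
rewrite !mxE (inj_eq enum_rank_inj) => <-.
rewrite sumT; apply: eq_bigr => k _.
by rewrite !mxE enum_rankK enum_valK.
Qed.

(** * The energy form and its bound from a proper colouring *)

Definition energy (R : realFieldType) (T : finType) (k : T -> T -> R) (p : T -> R)
    (f g : T -> R) : R :=
  \sum_x p x * f x * g x - \sum_x \sum_y k x y * f x * g y
  + (\sum_x p x * f x) * (\sum_x p x * g x).

Section Energy.
Variables (R : realFieldType) (T : finType) (k : T -> T -> R) (p : T -> R).
Hypothesis k_sym : forall x y, k x y = k y x.
Hypothesis k_marginal : forall x, \sum_y k x y = p x.

Lemma energyC f g : energy k p f g = energy k p g f.
Proof.
rewrite /energy [(\sum_x p x * f x) * _]mulrC; congr (_ - _ + _).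
  by apply: eq_bigr => x _; rewrite mulrAC.
rewrite exchange_big; apply: eq_bigr => x _; apply: eq_bigr => y _.
by rewrite k_sym mulrAC.
Qed.

Lemma energy_lin a b f g h :
  energy k p (fun x => a * f x + b * g x) h =
  a * energy k p f h + b * energy k p g h.
Proof.
rewrite /energy.
have -> : \sum_x p x * (a * f x + b * g x) * h x =
    a * (\sum_x p x * f x * h x) + b * (\sum_x p x * g x * h x).
  by rewrite !mulr_sumr -big_split; apply: eq_bigr => x _ /=; ring.
have -> : \sum_x \sum_y k x y * (a * f x + b * g x) * h y =
    a * (\sum_x \sum_y k x y * f x * h y) + b * (\sum_x \sum_y k x y * g x * h y).
  rewrite !mulr_sumr -big_split; apply: eq_bigr => x _ /=.
  by rewrite !mulr_sumr -big_split; apply: eq_bigr => y _ /=; ring.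
have -> : \sum_x p x * (a * f x + b * g x) =
    a * (\sum_x p x * f x) + b * (\sum_x p x * g x).
  by rewrite !mulr_sumr -big_split; apply: eq_bigr => x _ /=; ring.
ring.
Qed.

(** Expand the square: by symmetry and the marginals, each of the two square terms sums to that of
    [p x * f x ^+ 2]. This exhibits the first two terms of [energy k p f f] as half a sum of
    squares. *)
Lemma dirichlet f :
  \sum_x \sum_y k x y * (f x - f y) ^+ 2 =
  2 * (\sum_x p x * f x ^+ 2 - \sum_x \sum_y k x y * f x * f y).
Proof.
have sq_l : \sum_x \sum_y k x y * f x ^+ 2 = \sum_x p x * f x ^+ 2.
  by apply: eq_bigr => x _; rewrite -mulr_suml k_marginal.
have sq_r : \sum_x \sum_y k x y * f y ^+ 2 = \sum_x p x * f x ^+ 2.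
  rewrite exchange_big -sq_l; apply: eq_bigr => x _; apply: eq_bigr => y _.
  by rewrite k_sym.
rewrite mulrBr mulr_natl mulr2n -{1}sq_l -sq_r !mulr_sumr.
rewrite -big_split -sumrB; apply: eq_bigr => x _ /=.
rewrite mulr_sumr -big_split -sumrB; apply: eq_bigr => y _ /=.
ring.
Qed.

Hypothesis k_ge0 : forall x y, 0 <= k x y.

Lemma energy_ge0 f : 0 <= energy k p f f.
Proof.
have : 0 <= \sum_x \sum_y k x y * (f x - f y) ^+ 2.
  by do 2![apply: sumr_ge0 => ? _]; rewrite mulr_ge0 ?sqr_ge0.
rewrite dirichlet pmulr_rge0 // /energy -expr2 => dir.
rewrite addr_ge0 ?sqr_ge0 //.
by under eq_bigr do rewrite -mulrA -expr2.
Qed.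

Lemma energy_sub_ge0 f g :
  0 <= energy k p f f - 2 * energy k p f g + energy k p g g.
Proof.
have := energy_ge0 (fun x => 1 * f x + (-1) * g x).
rewrite energy_lin ![energy _ _ _ (fun x => _ + _)]energyC !energy_lin.
rewrite [energy _ _ g f]energyC; congr (0 <= _); ring.
Qed.

Hypothesis p_sum : \sum_x p x = 1.

(** The first two terms cancel against a constant, since [k] has marginal [p]; only the product of
    means remains. *)
Lemma energy1 f : energy k p f (fun=> 1) = \sum_x p x * f x.
Proof.
rewrite /energy; under eq_bigr do rewrite mulr1.
under [X in _ - X]eq_bigr do under eq_bigr do rewrite mulr1.
under [X in _ - X]eq_bigr do rewrite -mulr_suml k_marginal.
by under [X in _ * X]eq_bigr do rewrite mulr1; rewrite p_sum subrr add0r mulr1.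
Qed.

Lemma energy_color n (c : T -> 'I_n) (W : T -> T -> R) :
    (forall x, 0 < p x) -> (forall x y, c x = c y -> k x y = 0) ->
    (forall f y, energy k p f (W^~ y) = f y) ->
  #|T|%:R - 1 + n%:R^-1 <= \sum_y p y * W y y.
Proof.
move=> p_gt0 c_proper W_inv; pose a : R := n%:R^-1.
pose m i : R := \sum_(x | c x == i) p x.
have m_gt0 y : 0 < m (c y).
  rewrite /m (bigD1 y) //= ltr_pwDl // sumr_ge0 // => x _; exact: ltW.
have W_diag y : (p y)^-1 - 1 + 2 * a - a ^+ 2 / m (c y) <= W y y.
  have py := p_gt0 y; have my := m_gt0 y.
  set M := m (c y) in my *.
  pose d x : R := (x == y)%:R; pose b x : R := (c x == c y)%:R.
  have p_d : \sum_x p x * d x = p y.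
    rewrite (bigD1 y) //= /d eqxx mulr1 big1 ?addr0 // => x /negPf ->.
    by rewrite mulr0.
  have p_b : \sum_x p x * b x = M.
    rewrite /M /m [RHS]big_mkcond; apply: eq_bigr => x _.
    by rewrite /b; case: eqP => _; rewrite ?mulr1 ?mulr0.
  (* The flow term vanishes, as [k] is zero between vertices of the same colour. The diagonal
     entries of [k] vanish for the same reason, which [E_dd] and [E_bd] use. *)
  have E_bb : energy k p b b = M + M ^+ 2.
    rewrite /energy p_b -expr2 [X in _ - X]big1 ?subr0 => [|x _].
      rewrite -[X in _ = X + _]p_b; congr (_ + _); apply: eq_bigr => x _.
      by rewrite /b; case: eqP => _; rewrite ?mulr1 ?mulr0.
    apply: big1 => z _; rewrite /b; case: eqP => [cx|_]; last by rewrite mulr0 mul0r.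
    case: eqP => [cz|_]; last by rewrite mulr0.
    by rewrite c_proper ?mul0r // cx.
  have E_d f : energy k p f d =
      p y * f y - \sum_x k x y * f x + (\sum_x p x * f x) * p y.
    rewrite /energy p_d; congr (_ - _ + _).
      rewrite (bigD1 y) //= /d eqxx mulr1 big1 ?addr0 // => x /negPf ->.
      by rewrite mulr0.
    apply: eq_bigr => x _.
    rewrite (bigD1 y) //= /d eqxx mulr1 big1 ?addr0 // => z /negPf ->.
    by rewrite mulr0.
  have E_dd : energy k p d d = p y + p y ^+ 2.
    rewrite E_d p_d {1}/d eqxx mulr1 big1 ?subr0 // => x _.
    by rewrite /d; case: eqP => [->|]; rewrite ?mulr0 // c_proper ?mul0r.
  have E_bd : energy k p b d = p y + M * p y.
    rewrite E_d p_b {1}/b eqxx mulr1 big1 ?subr0 // => x _.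
    by rewrite /b; case: eqP => [cx|]; rewrite ?mulr0 // c_proper ?mul0r.
  pose v x := (p y)^-1 * d x + 1 * (- (a / M) * b x + a * 1).
  pose w := W^~ y.
  have E_v h : energy k p v h = (p y)^-1 * energy k p d h
      - a / M * energy k p b h + a * energy k p (fun=> 1) h.
    by rewrite /v 2!energy_lin mul1r; ring.
  have E_vv : energy k p v v = (p y)^-1 + 1 + (a ^+ 2 - 2 * a) / M.
    rewrite E_v ![energy _ _ _ v]energyC !E_v [energy _ _ d b]energyC.
    rewrite E_dd E_bd E_bb ![energy _ _ (fun=> 1) _]energyC !energy1 p_d p_b.
    under eq_bigr do rewrite mulr1.
    rewrite p_sum; field.
    by rewrite !gt_eqF.
  have vy : v y = (p y)^-1 - a / M + a by rewrite /v /d /b !eqxx /=; ring.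
  have := energy_sub_ge0 w v.
  rewrite [energy _ _ w v]energyC !W_inv E_vv vy /w => h.
  rewrite -subr_ge0; apply: le_trans h _; rewrite le_eqVlt; apply/orP; left.
  by apply/eqP; field; rewrite !gt_eqF.
(* A nonempty class contributes 1 and an empty one 0, since 0 / 0 = 0; the colouring need not be
   onto, hence only an inequality. *)
have count_classes : \sum_y p y / m (c y) <= n%:R.
  rewrite (partition_big c xpredT) //=.
  apply: (@le_trans _ _ (\sum_(i < n) 1)); last by rewrite sumr_const card_ord.
  apply: ler_sum => i _.
  have -> : \sum_(x | c x == i) p x / m (c x) = m i / m i.
    by rewrite mulr_suml; apply: eq_bigr => x /eqP ->.
  by have [->|mi] := eqVneq (m i) 0; rewrite ?mul0r // mulfV.
apply: (@le_trans _ _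
    (\sum_y p y * ((p y)^-1 - 1 + 2 * a - a ^+ 2 / m (c y)))); last first.
  by apply: ler_sum => y _; rewrite ler_wpM2l ?W_diag // ltW.
have -> : \sum_y p y * ((p y)^-1 - 1 + 2 * a - a ^+ 2 / m (c y)) =
    #|T|%:R + (2 * a - 1) * (\sum_y p y) - a ^+ 2 * \sum_y p y / m (c y).
  rewrite -sum1_card natr_sum !mulr_sumr -big_split -sumrB /=.
  apply: eq_bigr => y _; field.
  by rewrite !gt_eqF.
have a2n : a ^+ 2 * n%:R = a.
  rewrite /a; have [->|n0] := eqVneq n%:R (0 : R); first by rewrite invr0 mulr0.
  by rewrite expr2 mulfVK.
(* The subtracted term is at most [a ^+ 2 * n = a], leaving [#|T| + (2 * a - 1) - a]. *)
have := ler_wpM2l (sqr_ge0 a) count_classes.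
rewrite a2n p_sum -/a; lra.
Qed.

End Energy.

(** * First passage times and survival probabilities *)

Lemma geometric_bound (R : realFieldType) (x c : R) n :
  0 <= x -> x < 1 -> (1 - x) * c = 1 -> n.+1%:R * x ^+ n <= c.
Proof.
move=> x0 x1 xc.
have c_ge0 : 0 <= c by rewrite -(pmulr_rge0 c (_ : 0 < 1 - x)) ?xc ?subr_gt0.
(* Here [c] is the sum of the whole geometric series, so it bounds the first [n.+1] terms, each of
   which is at least [x ^+ n]. *)
have sum_le : \sum_(t < n.+1) x ^+ t <= c.
  have -> : \sum_(t < n.+1) x ^+ t = (1 - x ^+ n.+1) * c.
    by rewrite -opprB subrX1 -mulNr opprB mulrAC xc mul1r.
  by rewrite ler_piMl // gerBl exprn_ge0.
apply: le_trans sum_le; rewrite mulr_natl -{1}[n.+1]card_ord -sumr_const.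
by apply: ler_sum => t _; rewrite ler_wiXn2l // ?ltW // -ltnS.
Qed.

Lemma big_tuple_cons (V : nmodType) (T : finType) n (P : pred (seq T))
    (F : seq T -> V) :
  \sum_(w : n.+1.-tuple T | P w) F w =
  \sum_x \sum_(w : n.-tuple T | P (x :: w)) F (x :: w).
Proof.
rewrite pair_big_dep /=.
rewrite (reindex (fun xw : T * n.-tuple T => [tuple of xw.1 :: xw.2])) //=.
exists (fun w : n.+1.-tuple T => (thead w, [tuple of behead w])).
  by case=> x w _; rewrite theadE; congr pair; apply: val_inj.
by move=> w _; rewrite [w in RHS]tuple_eta.
Qed.

(* The probability, from [j], that [X_1, ..., X_n] all avoid [i]; [j = i] is
   allowed. *)
Fixpoint survival (R : nzRingType) (T : finType) (P : T -> T -> R) (i : T)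
    (n : nat) (j : T) : R :=
  if n is n'.+1 then \sum_(m | m != i) P j m * survival P i n' m else 1.

Section FirstPassage.
Variables (R : realType) (G : sgraph).
Hypothesis sum_transition : forall x : G, \sum_y transition R x y = 1.

Local Notation P := (@transition R G).

(** First hitting [i] at step [n.+1] means avoiding it for [n] steps but not for [n.+1]. The
    induction conditions on the first step, which must avoid [i] when the passage time exceeds 1. *)
Lemma first_passage_prob_survival (j i : G) n :
  first_passage_prob R j i n.+1 = survival P i n j - survival P i n.+1 j.
Proof.
elim: n j => [|n IHn] j.
  rewrite /first_passage_prob.
  rewrite (big_tuple_cons _ (fun w => (index i w).+1 == 1%N) (walk_prob R j)).
  have -> : survival P i 1 j = 1 - P j i.
    rewrite -(sum_transition j) [X in _ = X - _](bigD1 i) //= addrAC subrr add0r.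
    by apply: eq_bigr => m _; rewrite mulr1.
  rewrite subKr (bigD1 i) //= [X in _ + X]big1 => [|x /negPf xi]; last first.
    by rewrite big_pred0 // => w; rewrite eq_sym xi.
  rewrite addr0 (big_pred1 [tuple]) ?mulr1 // => w.
  by rewrite (tuple0 w) !eqxx.
transitivity (\sum_(m | m != i) P j m * first_passage_prob R m i n.+1).
  rewrite /first_passage_prob.
  rewrite (big_tuple_cons _ (fun w => (index i w).+1 == n.+2) (walk_prob R j)).
  rewrite [RHS]big_mkcond; apply: eq_bigr => x _ /=.
  have [->|xi] := eqVneq x i; first by rewrite big_pred0.
  rewrite mulr_sumr; apply: eq_bigl => w; by rewrite eqSS.
under eq_bigr do rewrite IHn mulrBr.
by rewrite sumrB.
Qed.

(** Summation by parts; the term at [t = 0] is killed by its factor. *)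
Lemma first_passage_prob_partial_mean (j i : G) n :
  \sum_(0 <= t < n.+1) t%:R * first_passage_prob R j i t =
  \sum_(t < n) survival P i t j - n%:R * survival P i n j.
Proof.
elim: n => [|n IHn]; first by rewrite big_nat1 big_ord0 !mul0r subr0.
rewrite big_nat_recr //= IHn first_passage_prob_survival big_ord_recr /=.
by rewrite -natr1; ring.
Qed.

Lemma transition_ge0 x y : 0 <= P x y.
Proof. by rewrite /transition divr_ge0. Qed.

Lemma walk_prob_ge0 (x : G) w : 0 <= walk_prob R x w.
Proof. by elim: w x => //= y w IHw x; rewrite mulr_ge0 ?transition_ge0. Qed.

Lemma first_passage_prob_ge0 (j i : G) t : 0 <= first_passage_prob R j i t.
Proof. by apply: sumr_ge0 => w _; exact: walk_prob_ge0. Qed.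

Lemma survival_ge0 (j i : G) n : 0 <= survival P i n j.
Proof.
elim: n j => //= n IHn j.
by apply: sumr_ge0 => m _; rewrite mulr_ge0 ?transition_ge0.
Qed.

(** The partial means come arbitrarily close to [H j]: iterating the first-step equations writes
    [H j] as a sum of survival probabilities plus a remainder that decays geometrically. *)
Lemma mean_first_passage_ge (i : G) (H : G -> R) :
  (forall j, H j = 1 + \sum_(m | m != i) P j m * H m) ->
  forall j, ((H j)%:E <= mean_first_passage R j i)%E.
Proof.
move=> H_eq.
(* Minimum principle: if the minimum [H l] were negative, leaving out the term at [i] could only
   help, and the equation at [l] would give [1 + H l <= H l]. *)
have H_ge1 j : 1 <= H j.
  case: (arg_minP H (erefl : xpredT j)) => l _ l_min.
  suff Hl : 0 <= H l.
    rewrite H_eq lerDl; apply: sumr_ge0 => m _.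
    by rewrite mulr_ge0 ?transition_ge0 // (le_trans Hl) ?l_min.
  rewrite leNgt; apply/negP => Hl.
  suff : 1 + H l <= H l by rewrite gerDr ler10.
  rewrite {2}(H_eq l) lerD2l.
  apply: (@le_trans _ _ (\sum_m P l m * H l)).
    by rewrite -mulr_suml sum_transition mul1r.
  rewrite [leRHS]big_mkcond; apply: ler_sum => m _.
  case: eqP => _ /=; first by rewrite mulr_ge0_le0 ?transition_ge0 ?ltW.
  by rewrite ler_wpM2l ?transition_ge0 ?l_min.
move=> j.
(* Any common upper bound of [H] above 1 would do: [H m <= c] is what gives
   [H m - 1 <= (1 - c^-1) * H m]. *)
pose c := 1 + \sum_m H m.
have H_le m : H m <= c.
  rewrite /c (bigD1 m) //= addrCA lerDl addr_ge0 // sumr_ge0 // => x _.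
  exact: le_trans (H_ge1 x).
have c1 : 1 < c.
  rewrite /c ltrDl (bigD1 j) //= ltr_pwDl ?(lt_le_trans _ (H_ge1 j)) //.
  by apply: sumr_ge0 => m _; exact: le_trans (H_ge1 m).
have c0 : 0 < c by exact: lt_trans c1.
pose x := 1 - c^-1.
have x0 : 0 <= x by rewrite subr_ge0 invf_le1 // ltW.
have x1 : x < 1 by rewrite gtrBl invr_gt0.
have xc : (1 - x) * c = 1 by rewrite /x subKr mulVf // gt_eqF.
(* With Q the matrix P without column i, D n = Q ^ n H, and Q H = H - 1 <= x H
   makes it decay geometrically; it dominates the survival probabilities. *)
pose D n m := H m - \sum_(t < n) survival P i t m.
have D_rec n m : D n.+1 m = \sum_(l | l != i) P m l * D n l.
  rewrite /D big_ord_recl [in LHS]H_eq /=.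
  under [RHS]eq_bigr do rewrite mulrBr mulr_sumr.
  by rewrite sumrB [in RHS]exchange_big /=; ring.
have D_ge n m : survival P i n m <= D n m.
  elim: n m => [|n IHn] m; first by rewrite /D big_ord0 subr0 H_ge1.
  rewrite D_rec; apply: ler_sum => l _.
  by rewrite ler_wpM2l ?transition_ge0.
have D_le n m : D n m <= x ^+ n * H m.
  elim: n m => [|n IHn] m; first by rewrite /D big_ord0 subr0 mul1r.
  rewrite D_rec; apply: (@le_trans _ _ (x ^+ n * (H m - 1))).
    rewrite [in leRHS]H_eq addrAC subrr add0r mulr_sumr; apply: ler_sum => l _.
    by rewrite mulrCA ler_wpM2l ?transition_ge0.
  rewrite exprSr -mulrA ler_wpM2l ?exprn_ge0 // /x mulrBl mul1r lerD2l lerN2.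
  by rewrite mulrC ler_pdivrMr // mul1r.
(* The shortfall is [D + 2n * survival <= (2n + 1) * D] at time [2n]. Doubling the time splits the
   decay into two factors [x ^+ n]: one absorbs the linear factor, the other is at most
   [c / n.+1]. *)
have partial_ge n : H j - 2 * c ^+ 3 / n.+1%:R <=
    \sum_(0 <= t < n.*2.+1) t%:R * first_passage_prob R j i t.
  rewrite first_passage_prob_partial_mean.
  have surv : survival P i n.*2 j <= D n.*2 j by [].
  have D_small : n.*2.+1%:R * D n.*2 j <= 2 * c ^+ 3 / n.+1%:R.
    have b := geometric_bound n x0 x1 xc.
    have xn : x ^+ n <= c / n.+1%:R by rewrite ler_pdivlMr // mulrC.
    have n2 : n.*2.+1%:R <= 2 * n.+1%:R :> R.
      by rewrite -natrM ler_nat mul2n doubleS.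
    apply: (@le_trans _ _ (2 * n.+1%:R * (x ^+ n * x ^+ n * c))).
      apply: ler_pM => //; first exact: le_trans (survival_ge0 _ _ _) surv.
      by rewrite -exprD addnn (le_trans (D_le _ _)) // ler_wpM2l ?exprn_ge0.
    have -> : 2 * n.+1%:R * (x ^+ n * x ^+ n * c) =
        2 * c * ((n.+1%:R * x ^+ n) * x ^+ n) by ring.
    have -> : 2 * c ^+ 3 / n.+1%:R = 2 * c * (c * (c / n.+1%:R)) by ring.
    apply: ler_wpM2l; first by rewrite mulr_ge0 ?ltW.
    apply: ler_pM => //.
      by rewrite mulr_ge0 ?exprn_ge0.
    exact: exprn_ge0.
  rewrite -[n.*2.+1%:R]natr1 mulrDl mul1r in D_small.
  have := ler_wpM2l (ler0n _ n.*2) surv.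
  have : D n.*2 j = H j - \sum_(t < n.*2) survival P i t j by [].
  have := D_small; move: (2 * c ^+ 3 / _) (D n.*2 j) => C' D'; lra.
have partial_le n : ((H j - 2 * c ^+ 3 / n.+1%:R)%:E <= mean_first_passage R j i)%E.
  apply: le_trans (nneseries_lim_ge n.*2.+1 _); last first.
    by move=> t _ _; rewrite lee_fin mulr_ge0 ?first_passage_prob_ge0.
  by rewrite sumEFin lee_fin.
apply/lee_subgt0Pr => e e0; rewrite -EFinB.
have C0 : 0 < 2 * c ^+ 3 by rewrite mulr_gt0 ?exprn_gt0.
have [n n_gt] : exists n : nat, 2 * c ^+ 3 / e < n%:R.
  by exists (Num.bound (2 * c ^+ 3 / e)); rewrite archi_boundP // ltW // divr_gt0.
apply: le_trans (partial_le n); rewrite lee_fin lerD2l lerN2.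
rewrite ler_pdivrMr // -ler_pdivrMl // [leLHS]mulrC ltW // (lt_le_trans n_gt) //.
by rewrite ler_nat.
Qed.
End FirstPassage.

(** * Connected graphs: reversibility, the inverse of the energy form, Kemeny's constant *)

Lemma connect_const (T : finType) (U : Type) (e : rel T) (f : T -> U) :
  (forall x y, e x y -> f x = f y) -> forall x y, connect e x y -> f x = f y.
Proof.
move=> f_e x y /connectP[s].
elim: s x => [x _ -> //|z s IHs x /= /andP[xz zs] y_last].
by rewrite (f_e _ _ xz); exact: IHs.
Qed.

Section ConnectedGraph.
Variables (R : realType) (G : sgraph).
Hypothesis G_connected : connected_graph G.

Lemma dirichlet_eq0_const (k : G -> G -> R) (f : G -> R) :
    (forall x y, 0 <= k x y) -> (forall x y, adj x y -> 0 < k x y) ->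
    \sum_x \sum_y k x y * (f x - f y) ^+ 2 = 0 ->
  forall x y, f x = f y.
Proof.
move=> k_ge0 k_gt0 sum0 x y.
apply: connect_const (G_connected x y) => {x y} x y xy.
have /psumr_eq0P := sum0.
move=> /(_ (fun _ _ => sumr_ge0 _ (fun _ _ => mulr_ge0 (k_ge0 _ _) (sqr_ge0 _)))).
move=> /(_ x isT)/psumr_eq0P.
move=> /(_ (fun _ _ => mulr_ge0 (k_ge0 _ _) (sqr_ge0 _)))/(_ y isT)/eqP.
by rewrite mulf_eq0 gt_eqF ?k_gt0 // sqrf_eq0 subr_eq0 => /eqP.
Qed.

Hypothesis n_ge2 : (2 <= #|G|)%N.

Lemma degree_gt0 (x : G) : (0 < degree x)%N.
Proof.
have [y xy] : exists y, y != x.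
  have /card_gt0P[y] : (0 < #|[set~ x]|)%N.
    by rewrite cardsC1; case: #|G| n_ge2 => [|[]].
  by rewrite !inE; exists y.
have /connectP[[|z s] /= z_path y_last] := G_connected x y.
  by rewrite y_last eqxx in xy.
by apply/card_gt0P; exists z; rewrite inE; case/andP: z_path.
Qed.

Let deg_gt0 (x : G) : 0 < (degree x)%:R :> R.
Proof. by rewrite ltr0n degree_gt0. Qed.

Lemma sum_adj (x : G) : \sum_y (adj x y)%:R = (degree x)%:R :> R.
Proof.
rewrite -natr_sum /degree cardsE -sum1_card [in RHS]big_mkcond.
by congr _%:R; apply: eq_bigr => y _; rewrite unfold_in /=; case: (adj x y).
Qed.

Lemma sum_transition (x : G) : \sum_y transition R x y = 1.
Proof. by rewrite -mulr_suml sum_adj mulfV // gt_eqF. Qed.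

Variable p : G -> R.
Hypothesis p_stationary : stationary p.

(** Stationarity makes the density [f = p / degree] harmonic, so its Dirichlet sum over the edges
    vanishes and [f] is constant by connectedness. The constant is positive because [p] has total
    mass 1. *)
Lemma stationary_degree :
  exists2 c : R, 0 < c & forall x, p x = c * (degree x)%:R.
Proof.
have [p_ge0 p_sum p_inv] := p_stationary.
pose f x := p x / (degree x)%:R.
have f_p x : (degree x)%:R * f x = p x by rewrite mulrC divfK ?gt_eqF.
have f_const : forall x y, f x = f y.
  apply: (@dirichlet_eq0_const (fun x y => (adj x y)%:R)) => [//|x y -> //|].
  rewrite (dirichlet (p := fun x => (degree x)%:R)) //; last exact: sum_adj.
    rewrite exchange_big -sumrB big1 ?mulr0 // => y _.
    rewrite -mulr_suml expr2 mulrA f_p -p_inv -mulrBl.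
    under [X in _ - X]eq_bigr do rewrite /f mulrCA.
    by rewrite subrr mul0r.
  by move=> x y; rewrite adj_sym.
have /card_gt0P[x0 _] : (0 < #|G|)%N by exact: ltn_trans n_ge2.
have p_f x : p x = f x0 * (degree x)%:R by rewrite (f_const x0 x) mulrC f_p.
exists (f x0) => //; rewrite lt_def divr_ge0 // andbT.
apply: contra_eqN p_sum => /eqP f0.
rewrite big1 => [|x _]; first by rewrite eq_sym oner_eq0.
by rewrite p_f f0 mul0r.
Qed.

Lemma stationary_gt0 x : 0 < p x.
Proof. by have [c c0 ->] := stationary_degree; rewrite mulr_gt0. Qed.

Lemma detailed_balance x y : p x * transition R x y = p y * transition R y x.
Proof.
have [c _ pE] := stationary_degree; rewrite !pE /transition adj_sym.
by field; rewrite !gt_eqF.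
Qed.

Let k x y := p x * transition R x y.

Let k_marginal x : \sum_y k x y = p x.
Proof. by rewrite -mulr_sumr sum_transition mulr1. Qed.

Let k_ge0 x y : 0 <= k x y.
Proof. by rewrite mulr_ge0 ?transition_ge0 // ltW ?stationary_gt0. Qed.

(** [S] is the kernel of the form. If [S] kills [h], then [h] has zero energy, which is half its
    Dirichlet sum plus its squared mean; so [h] is constant with mean 0, hence zero, and [S] is
    invertible. *)
Lemma energy_green :
  exists W : G -> G -> R, forall f y, energy k p f (W^~ y) = f y.
Proof.
have [_ p_sum _] := p_stationary.
pose S x y : R := p x * (x == y)%:R - k x y + p x * p y.
have S_sum g x : \sum_y S x y * g y =
    p x * g x - \sum_y k x y * g y + p x * \sum_y p y * g y.
  rewrite mulr_sumr; under eq_bigr do rewrite /S mulrDl mulrBl -[p x * p _ * _]mulrA.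
  rewrite big_split sumrB /=; congr (_ - _ + _).
  rewrite (bigD1 x) //= eqxx mulr1 big1 ?addr0 // => y.
  by rewrite eq_sym => /negPf ->; rewrite mulr0 mul0r.
have energyE f g : energy k p f g = \sum_x f x * \sum_y S x y * g y.
  under [RHS]eq_bigr do rewrite S_sum mulrDr mulrBr.
  rewrite big_split sumrB /= /energy mulr_suml; congr (_ - _ + _).
  - by apply: eq_bigr => x _; ring.
  - by apply: eq_bigr => x _; rewrite mulr_sumr; apply: eq_bigr => y _; ring.
  - by apply: eq_bigr => x _; ring.
have [h Sh0 x|W W_inv] := @kernel_right_inverse R G S; last first.
  exists W => f y; rewrite energyE (bigD1 y) //= W_inv eqxx mulr1.
  by rewrite big1 ?addr0 // => x /negPf xy; rewrite W_inv xy mulr0.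
have /eqP : energy k p h h = 0.
  by rewrite energyE big1 // => z _; rewrite Sh0 mulr0.
have dir_ge0 : 0 <= \sum_x \sum_y k x y * (h x - h y) ^+ 2.
  by do 2![apply: sumr_ge0 => ? _]; rewrite mulr_ge0 ?sqr_ge0.
have dir := dirichlet detailed_balance k_marginal h.
have -> : energy k p h h =
    (\sum_x \sum_y k x y * (h x - h y) ^+ 2) / 2 + (\sum_x p x * h x) ^+ 2.
  rewrite dir mulrC mulKf ?pnatr_eq0 // /energy -expr2; congr (_ - _ + _).
  by apply: eq_bigr => z _; rewrite -mulrA.
rewrite paddr_eq0 ?sqr_ge0 ?divr_ge0 // mulf_eq0 invr_eq0 pnatr_eq0 orbF.
rewrite sqrf_eq0 => /andP[/eqP dir0 /eqP ph0].
have h_const := @dirichlet_eq0_const k h k_ge0 _ dir0.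
rewrite -[LHS]mul1r -p_sum mulr_suml -[RHS]ph0; apply: eq_bigr => y _.
rewrite (h_const _ x y) // => a b ab.
by rewrite mulr_gt0 ?stationary_gt0 // /transition ab divr_gt0.
Qed.

Lemma colorable_kemeny (n : nat) (j : G) : colorable G n ->
  ((#|G|%:R - 2 + n%:R^-1)%:E <= kemeny p j)%E.
Proof.
move=> /existsP[c /forallP c_col].
have [p_ge0 p_sum _] := p_stationary.
have [W W_inv] := energy_green.
have c_proper x y : c x = c y -> k x y = 0.
  move=> cxy; have := forallP (c_col x) y; rewrite cxy eqxx implybF => /negPf xy.
  by rewrite /k /transition xy mul0r mulr0.
have trace := energy_color detailed_balance k_marginal k_ge0 p_sum stationary_gt0
  c_proper W_inv.
(* Both sides are the energy of the columns of [W] at [x] and [y]. *)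
have W_sym x y : W x y = W y x.
  by rewrite -(W_inv (W^~ y)) energyC ?W_inv //; exact: detailed_balance.
have W_sum y : \sum_x p x * W x y = 1.
  by rewrite -(energy1 k_marginal p_sum) energyC ?W_inv //; exact: detailed_balance.
(* Testing the column of [W] at [y] against the indicator of [x] yields the pointwise equation;
   [W_sum] turns the rank-one term into [p x]. *)
have W_eq x y : p x * (W x y - \sum_z transition R x z * W z y + 1) = (x == y)%:R.
  rewrite -(W_inv (fun z => (x == z)%:R) y) /energy.
  have pick (F : G -> R) : \sum_z F z * (x == z)%:R = F x.
    rewrite (bigD1 x) //= eqxx mulr1 big1 ?addr0 // => z.
    by rewrite eq_sym => /negPf ->; rewrite mulr0.
  have p_pick : \sum_z p z * (x == z)%:R * W z y = p x * W x y.
    by rewrite -(pick (fun z => p z * W z y)); apply: eq_bigr => z _; rewrite mulrAC.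
  have k_pick : \sum_z \sum_a k z a * (x == z)%:R * W a y =
      p x * \sum_a transition R x a * W a y.
    rewrite -(pick (fun z => p z * \sum_a transition R z a * W a y)).
    apply: eq_bigr => z _; rewrite mulr_sumr mulr_suml.
    by apply: eq_bigr => a _; rewrite /k; ring.
  by rewrite p_pick k_pick pick W_sum; ring.
pose H i j := W i i - W j i + (j == i)%:R / p i.
(* Without its correction at [j = i], [H i] vanishes at [i], so the restricted sum becomes a full
   one; [W_eq] then supplies the correction at [l]. *)
have H_eq i l : H i l = 1 + \sum_(m | m != i) transition R l m * H i m.
  have -> : \sum_(m | m != i) transition R l m * H i m =
      \sum_m transition R l m * (W i i - W m i).
    rewrite [RHS](bigD1 i) //= subrr mulr0 add0r; apply: eq_bigr => m /negPf mi.
    by rewrite /H mi mul0r addr0.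
  under eq_bigr do rewrite mulrBr.
  rewrite sumrB -mulr_suml sum_transition mul1r /H.
  have pl := stationary_gt0 l.
  have -> : (l == i)%:R / p i = (l == i)%:R / p l.
    by have [->|_] := eqVneq l i; rewrite ?mul0r.
  by rewrite -W_eq; field; rewrite gt_eqF.
(* The mean of [W i j] over [i] and the sum of the corrections are both 1 and cancel, leaving the
   trace. *)
have H_sum : \sum_i p i * H i j = \sum_i p i * W i i.
  have -> : \sum_i p i * H i j =
      \sum_i p i * W i i - \sum_i p i * W i j + \sum_i (j == i)%:R.
    rewrite -sumrB -big_split; apply: eq_bigr => i _ /=.
    by rewrite /H (W_sym j i); field; rewrite gt_eqF // stationary_gt0.
  have -> : \sum_i (j == i)%:R = 1 :> R.
    rewrite (bigD1 j) //= eqxx big1 ?addr0 // => i.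
    by rewrite eq_sym => /negPf ->.
  by rewrite W_sum subrK.
rewrite /kemeny.
have -> : #|G|%:R - 2 + n%:R^-1 = #|G|%:R - 1 + n%:R^-1 - 1 :> R by ring.
rewrite EFinB; apply: leeB => //.
apply: (@le_trans _ _ (\sum_i (p i * H i j)%:E)%E).
  by rewrite sumEFin lee_fin H_sum.
apply: lee_sum => i _; rewrite EFinM; apply: lee_wpmul2l; rewrite ?lee_fin //.
by apply: mean_first_passage_ge => //; exact: sum_transition.
Qed.

End ConnectedGraph.

Theorem corollary4p3 (R : realType) (G : sgraph) (p : G -> R) (j : G)
    (n_ge2 : (2 <= #|G|)%N) (G_connected : connected_graph G)
    (p_stationary : stationary p) :
  (1 / (kemeny p j - #|G|%:R%:E + 2%:E) <= (chromatic_number G)%:R%:E)%E.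
Proof.
have col : colorable G (chromatic_number G).
  by rewrite /chromatic_number; case: ex_minnP.
have k_gt0 : (0 < chromatic_number G)%N.
  by case/existsP: col => c _; exact: leq_ltn_trans (ltn_ord (c j)).
have := colorable_kemeny G_connected n_ge2 p_stationary j col.
have kV_gt0 : 0 < (chromatic_number G)%:R^-1 :> R by rewrite invr_gt0 ltr0n.
(* The lower bound excludes the value -oo, and at +oo the inverse is 0. In the finite case it makes
   the denominator positive, so that inverting reverses the inequality. *)
rewrite div1e; case: (kemeny p j) => [K||] //=; last first.
  by move=> _; rewrite invey lee_fin.
rewrite -!EFinD !lee_fin => K_ge.
have K_ge' : (chromatic_number G)%:R^-1 <= K - #|G|%:R + 2 by lra.
have K_gt0 := lt_le_trans kV_gt0 K_ge'.
rewrite inver gt_eqF // lee_fin -[leRHS]invrK lef_pV2 ?posrE //.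
Qed.
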